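(* Let $\mathcal H$ be a complex Hilbert space, let $n,m\in\mathbb N$ with $n,m\ge1$, and let $A_i,C_i,D_i\in B(\mathcal H)$ for $i=1,\dots,n$. Then for all real $r\ge1$, $$w^r\Big(\sum_{i=1}^{n}D_iC_i^{m}A_i\Big)\le \frac{n^{r-1}}{2m}\sum_{j=1}^{m}\Big\|\sum_{i=1}^{n}\Big(|C_i^{j}A_i|^{2r}+|(D_iC_i^{m-j})^*|^{2r}\Big)\Big\|.$$
   Context: $B(\mathcal H)$ is the $C^*$-algebra of bounded linear operators on $\mathcal H$ and $\|\cdot\|$ is the usual operator norm. For $T\in B(\mathcal H)$, $w(T)=\sup\{|\langle T\xi,\xi\rangle|:\xi\in\mathcal H,\ \|\xi\|=1\}$ is the numerical radius, $w^r(T)=(w(T))^r$, and $|T|=(T^*T)^{1/2}$. Real powers of positive operators are taken by continuous functional calculus, and $T^0=I$. *)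

(* Defs.v *)
From HB Require Import structures.
From mathcomp Require Import all_boot all_order all_algebra.
From mathcomp Require Import complex.
From mathcomp Require Import all_classical all_reals all_analysis.

Set Implicit Arguments.
Unset Strict Implicit.
Unset Printing Implicit Defensive.

Import Order.TTheory GRing.Theory Num.Theory.
Import numFieldNormedType.Exports.

Local Open Scope classical_set_scope.
Local Open Scope complex_scope.
Local Open Scope ring_scope.

(* The inner product is linear in its first argument; the norm of a module over
   R[i] takes its values in R[i] (in the nonnegative reals). *)
HB.mixin Record NormedModule_isHilbert (R : realType) H
    & CompleteNormedModule R[i] H := {
  hdot : {dot H for Num.conj : R[i] -> R[i]} ;
  hdot_normE : forall x : H, hdot x x = `|x| ^+ 2 }.

#[short(type="hilbertType")]
HB.structure Definition Hilbert (R : realType) :=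
  { H of CompleteNormedModule R[i] H & NormedModule_isHilbert R H }.

Section BoundedOperators.
Context {R : realType} (H : hilbertType R).

Definition bounded_op : {pred H -> H} := [pred T : H -> H |
  `[< linear T /\ exists M : R, forall x : H, `|T x| <= M%:C * `|x| >] ].

Record bop := Bop { bop_fun :> H -> H ; _ : bop_fun \in bounded_op }.

HB.instance Definition _ := [isSub for bop_fun].
HB.instance Definition _ := [Choice of bop by <:].

Lemma bounded_op_submod_closed : submod_closed bounded_op.
Proof.
split.
  apply/asboolP; split=> [a x y|]; first by rewrite -[RHS]/(a *: (0 : H) + 0) scaler0 addr0.
  by exists 0 => x; rewrite -[_ x]/(0 : H) normr0 mul0r.
move=> a S T /asboolP[Sl [M SM]] /asboolP[Tl [N TN]]; apply/asboolP; split.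
  move=> b x y; rewrite -[LHS]/(a *: S (b *: x + y) + T (b *: x + y)) Sl Tl.
  rewrite -[RHS]/(b *: (a *: S x + T x) + (a *: S y + T y)).
  by rewrite !scalerDr !scalerA mulrC addrACA.
exists (complex.Re `|a| * M + N) => x.
rewrite -[X in `|X|]/(a *: S x + T x) rmorphD rmorphM /=.
rewrite -[(Normc.normc a)%:C]/`|a| mulrDl (le_trans (ler_normD _ _))//.
by rewrite lerD// normrZ -mulrA ler_wpM2l.
Qed.

HB.instance Definition _ :=
  GRing.isSubmodClosed.Build _ _ bounded_op bounded_op_submod_closed.
HB.instance Definition _ := [SubChoice_isSubLmodule of bop by <:].

Lemma bopP (T : bop) :
  linear T /\ exists M : R, forall x : H, `|T x| <= M%:C * `|x|.
Proof. exact: (asboolW (valP T)). Qed.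

HB.instance Definition _ (T : bop) :=
  GRing.isLinear.Build R[i] H H _ (T : H -> H) (bopP T).1.

Lemma bop_id_subproof : (idfun : H -> H) \in bounded_op.
Proof. by apply/asboolP; split=> //; exists 1 => x; rewrite mul1r. Qed.

Lemma bop_comp_subproof (S T : bop) : S \o T \in bounded_op.
Proof.
apply/asboolP; split=> [a x y|]; first by rewrite /= !linearP.
have [_ [M SM]] := bopP S; have [_ [N TN]] := bopP T.
exists (Num.max M 0 * N) => x /=; rewrite rmorphM /=.
apply: (@le_trans _ _ ((Num.max M 0)%:C * `|T x|)).
  by rewrite (le_trans (SM _))// ler_wpM2r// lecR le_max lexx.
by rewrite -mulrA ler_wpM2l// lecR le_max lexx orbT.
Qed.

Definition bop_one := Bop bop_id_subproof.
Definition bop_mul (S T : bop) := Bop (bop_comp_subproof S T).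

Lemma bop_ext (S T : bop) : (forall x, S x = T x) -> S = T.
Proof. by move=> ST; apply/val_inj/funext. Qed.

Fact bop_mulA : associative bop_mul. Proof. by move=> *; apply: bop_ext. Qed.
Fact bop_mul1r : left_id bop_one bop_mul.
Proof. by move=> *; apply: bop_ext. Qed.
Fact bop_mulr1 : right_id bop_one bop_mul.
Proof. by move=> *; apply: bop_ext. Qed.
Fact bop_mulDl : left_distributive bop_mul +%R.
Proof. by move=> *; apply: bop_ext. Qed.
Fact bop_mulDr : right_distributive bop_mul +%R.
Proof. by move=> S T U; apply: bop_ext => x /=; rewrite linearD. Qed.

(* Not an nzRing, as H may be the zero space. *)
HB.instance Definition _ := GRing.Zmodule_isPzRing.Build bop
  bop_mulA bop_mul1r bop_mulr1 bop_mulDl bop_mulDr.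

End BoundedOperators.

Notation "''B' ( H )" := (bop H) (at level 8, format "''B' ( H )") : type_scope.

Section Operators.
Context {R : realType} {H : hilbertType R}.
Implicit Types T : 'B(H).

Definition opnorm T : R :=
  sup [set complex.Re `|T x| | x in [set x : H | `|x| <= 1]].

Definition numrad T : R :=
  sup [set complex.Re `|hdot (T x) x| | x in [set x : H | `|x| = 1]].

(* Existence and uniqueness of S is the Riesz representation theorem. *)
Definition adjoint T : 'B(H) :=
  xget 0 [set S : 'B(H) | forall x y : H, hdot (T x) y = hdot x (S y)].

Definition spectrum T : set R[i] :=
  [set z | ~ exists S : 'B(H), S * (T - z *: (1 : 'B(H))) = 1 /\ (T - z *: (1 : 'B(H))) * S = 1].

Definition peval (p : {poly R}) T : 'B(H) :=
  \sum_(k < size p) (p`_k)%:C *: T ^+ k.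

(* Continuous functional calculus of a self-adjoint T (whose spectrum is real):
   f(T) is the limit in operator norm of p_k(T), for real polynomials p_k
   converging to f uniformly on the spectrum. *)
Definition fun_calc (f : R -> R) T : 'B(H) :=
  xget 0 [set F : 'B(H) | exists p : nat -> {poly R},
    {uniform [set t : R | spectrum T t%:C],
      (fun k t => (p k).[t]) @ \oo --> f} /\
    opnorm (peval (p k) T - F) @[k --> \oo] --> 0].

(* For self-adjoint T >= 0; recall that t `^ 0 = 1 for all t, so T^0 = 1. *)
Definition oppow T (s : R) : 'B(H) := fun_calc (fun t => t `^ s) T.

Definition opabs T : 'B(H) := oppow (adjoint T * T) 2^-1.

End Operators.

(* Main.v *)
Require Import Defs.
From HB Require Import structures.
From mathcomp Require Import all_boot all_order all_algebra.
From mathcomp Require Import complex.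
From mathcomp Require Import all_classical all_reals all_analysis.
From mathcomp Require Import ring lra zify.

(** Fix a unit vector [x].  For each [j] the operator is [\sum_i Y_i X_i] with
    [X_i = C_i^j A_i] and [Y_i = D_i C_i^(m-j)], so by Cauchy-Schwarz and AM-GM
    [|<T x, x>| <= 1/2 \sum_i (|X_i x|^2 + |Y_i^* x|^2)].  Since
    [|X x|^2 = <|X|^2 x, x>], convexity of [t `^ r] enters twice: as Jensen's
    inequality for the mean of these [2 n] numbers, and as McCarthy's inequality
    [<|X|^2 x, x>^r <= <|X|^(2r) x, x>].  Both are consequences of the tangent
    line of [t `^ r] at that mean, used for numbers and, through the functional
    calculus, for operators ([oppow_opabs_ge], [numrad_powR_le]).  Averaging the
    bounds over [j] gives the theorem.

    The rest of the work is operator theory.  Adjoints and inverses of coercive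
    self-adjoint operators come from one variational lemma ([coercive_riesz]).
    A real polynomial that is nonnegative on the spectrum of a self-adjoint
    operator [T] is sent to a positive operator ([peval_ge0]): otherwise the
    infimum [m < 0] of the numerical range of [p(T)] is an approximate
    eigenvalue, and splitting [p - m] into linear factors over the complex
    numbers exhibits a point of the spectrum where [p] takes the value [m].
    Together with Bernstein's approximation of the powers ([poly_approx]) this
    makes the limits defining [opabs] and [oppow] exist ([fun_calcP]) and
    carries inequalities between functions over to operators ([is_calc_ge]). *)

Set Implicit Arguments.
Unset Strict Implicit.
Unset Printing Implicit Defensive.

Import Order.TTheory GRing.Theory Num.Theory.
Import numFieldNormedType.Exports.

Local Open Scope ring_scope.

(** * Bernstein approximation *)

Section Bernstein.
Variable R : realType.
Implicit Types (g h : nat -> R) (x c a b eps K : R).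

(** The Bernstein polynomial [\sum_k 'C(n, k) g_k X^k (1 - X)^(n - k)], i.e. the
    expectation of [g] under the binomial law of parameter [X].  Conditioning
    on the first of the [n] trials gives this recursion, which turns the facts
    needed below into one-line inductions without binomial coefficients. *)
Fixpoint bern n g : {poly R} :=
  if n is n'.+1 then 'X * bern n' (g \o S) + (1 - 'X) * bern n' g
  else (g 0%N)%:P.

Lemma bernS n g x : (bern n.+1 g).[x] =
  x * (bern n (g \o S)).[x] + (1 - x) * (bern n g).[x].
Proof. by rewrite /= !hornerE. Qed.

Lemma bern_le n g h x : 0 <= x <= 1 ->
  (forall k, (k <= n)%N -> g k <= h k) -> (bern n g).[x] <= (bern n h).[x].
Proof.
move=> /andP[x0 x1]; elim: n g h => [|n IH] g h gh.
  by rewrite !hornerE gh.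
rewrite !bernS lerD// ler_wpM2l// ?subr_ge0// IH// => k kn; rewrite gh//.
exact: leqW.
Qed.

Lemma bern_affine n a b g x :
  (bern n (fun k => a + b * g k)).[x] = a + b * (bern n g).[x].
Proof.
elim: n g => [|n IH] g; first by rewrite !hornerE.
by rewrite !bernS IH (IH (g \o S)); ring.
Qed.

(** The second moment about [c] is the variance [n x (1 - x)] plus the squared
    bias.  Keeping [c] free is what makes the induction go through, since a
    success in the first trial shifts [c] by one. *)
Lemma bern_sqr n c x :
  (bern n (fun k => (k%:R - c) ^+ 2)).[x] =
  n%:R * (x * (1 - x)) + (n%:R * x - c) ^+ 2.
Proof.
elim: n c => [|n IH] c; first by rewrite !hornerE/=; ring.
rewrite bernS IH.
have -> : bern n ((fun k => (k%:R - c) ^+ 2) \o S) =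
    bern n (fun k => (k%:R - (c - 1)) ^+ 2).
  by congr bern; apply/funext => k /=; rewrite -natr1; ring.
by rewrite IH -natr1; ring.
Qed.

(** Chebyshev's argument: a modulus of continuity of the form
    [eps + K (a - b)^2] can be averaged against the binomial law, and the
    average of the quadratic part is [K] times the variance [x (1 - x) / n]. *)
Lemma bern_approx (f : R -> R) eps K n x : 0 <= x <= 1 -> 0 <= K ->
  (forall a b, 0 <= a <= 1 -> 0 <= b <= 1 ->
     `|f a - f b| <= eps + K * (a - b) ^+ 2) ->
  `|(bern n.+1 (fun k => f (k%:R / n.+1%:R))).[x] - f x| <= eps + K / n.+1%:R.
Proof.
move=> x01 K0 fK; set N : R := n.+1%:R; set F := bern _ _.
have N0 : 0 < N by rewrite ltr0n.
have xx : x * (1 - x) <= 1 by have /andP[x0 x1] := x01; nra.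
pose v k : R := (k%:R - N * x) ^+ 2.
have bv : K / N ^+ 2 * (bern n.+1 v).[x] <= K / N.
  rewrite bern_sqr subrr expr0n addr0 -/N.
  have -> : K / N ^+ 2 * (N * (x * (1 - x))) = K / N * (x * (1 - x)).
    by field; exact: lt0r_neq0.
  by rewrite -[leRHS]mulr1 ler_wpM2l// divr_ge0// ltW.
have fv k : (k <= n.+1)%N -> `|f (k%:R / N) - f x| <= eps + K / N ^+ 2 * v k.
  move=> kn; apply: le_trans (fK _ _ _ x01) _.
    by rewrite divr_ge0 ?ler0n//= ler_pdivrMr// mul1r ler_nat.
  rewrite lerD2l le_eqVlt; apply/orP; left; apply/eqP; rewrite /v; field.
  exact: lt0r_neq0.
have up : F.[x] <= f x + eps + K / N ^+ 2 * (bern n.+1 v).[x].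
  rewrite -bern_affine; apply: bern_le => // k kn /=.
  by have := fv k kn; rewrite ler_norml; move: (v k) (K / N ^+ 2) => w c /andP[? ?]; lra.
have lo : f x - eps + - (K / N ^+ 2) * (bern n.+1 v).[x] <= F.[x].
  rewrite -bern_affine; apply: bern_le => // k kn /=.
  by have := fv k kn; rewrite ler_norml; move: (v k) (K / N ^+ 2) => w c /andP[? ?]; lra.
move: bv up lo; rewrite mulNr; move: (_ * (bern _ v).[x]) (K / N) => w c ? ? ?.
by rewrite ler_norml; apply/andP; split; lra.
Qed.

(** Weierstrass' theorem on [[0, M]].  The hypothesis is what uniform continuity
    gives for a bounded [f]: distances beyond the modulus of continuity are
    absorbed by the quadratic term. *)
Lemma poly_approx (f : R -> R) (M : R) : 0 < M ->
  (forall eps, 0 < eps -> exists K, forall a b, 0 <= a <= M -> 0 <= b <= M ->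
     `|f a - f b| <= eps + K * (a - b) ^+ 2) ->
  forall eps, 0 < eps -> exists p : {poly R}, forall t, 0 <= t <= M ->
    `|p.[t] - f t| <= eps.
Proof.
move=> M0 fK eps eps0.
have [|K0 fK0] := fK (eps / 2); first lra.
pose K := `|K0| * M ^+ 2; pose n := Num.Def.truncn (K / (eps / 2)).
have Kn : K / n.+1%:R <= eps / 2.
  rewrite ler_pdivrMr ?ltr0n// mulrC -ler_pdivrMr; last lra.
  by apply: ltW; rewrite real_truncnS_gt// num_real.
exists (bern n.+1 (fun k => f (M * (k%:R / n.+1%:R))) \Po (M^-1 *: 'X)).
move=> t /andP[t0 tM]; rewrite horner_comp hornerZ hornerX.
have := @bern_approx (fun s => f (M * s)) (eps / 2) K n (M^-1 * t).
rewrite (mulrA M) divff ?lt0r_neq0// mul1r => H.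
apply: le_trans (H _ _ _) _ => {H}.
- by rewrite mulr_ge0 ?invr_ge0 ?(ltW M0)//= mulrC ler_pdivrMr// mul1r.
- by rewrite mulr_ge0// sqr_ge0.
- move=> a b a01 b01; apply: le_trans (fK0 _ _ _ _) _; [nra|nra|].
  rewrite lerD2l /K -mulrBr exprMn mulrA ler_wpM2r ?sqr_ge0//.
  by rewrite ler_wpM2r ?sqr_ge0// ler_norm.
- by move: Kn; move: (K / _) => c; lra.
Qed.

End Bernstein.

(** * Real powers *)

Section Powers.
Variable R : realType.
Implicit Types (r s t a b mu M eps : R).

(** The convex function [t `^ r] lies above its tangent line at [mu]; this is
    Young's inequality for the conjugate exponents [r] and [r / (r - 1)]. *)
Lemma powR_tangent r t mu : 1 <= r -> 0 <= t -> 0 <= mu ->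
  r * mu `^ (r - 1) * t - (r - 1) * mu `^ r <= t `^ r.
Proof.
move=> + t0 mu0; rewrite le_eqVlt => /predU1P[<-|r1].
  by rewrite subrr powRr0 !powRr1// mul0r subr0 !mul1r.
have r0 : 0 < r by lra.
have rN0 : r - 1 != 0 by lra.
have := @conjugate_powR R t (mu `^ (r - 1)) r (r / (r - 1)) t0 (powR_ge0 _ _) r0.
rewrite -powRrM [(r - 1) * _]mulrC divfK// invf_div.
have -> : r^-1 + (r - 1) / r = 1 by field; exact: lt0r_neq0.
move=> /(_ (divr_gt0 r0 _) erefl) H; have {H} := H (ltac:(lra)).
rewrite -(ler_pM2l r0).
have -> : r * (t `^ r / r + mu `^ r * ((r - 1) / r)) =
    t `^ r + (r - 1) * mu `^ r by field; exact: lt0r_neq0.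
lra.
Qed.

Lemma sqrt_modulus M eps : 0 < eps ->
  exists K, forall a b, 0 <= a <= M -> 0 <= b <= M ->
    `|a `^ 2^-1 - b `^ 2^-1| <= eps + K * (a - b) ^+ 2.
Proof.
move=> e0.
(* With [d] the distance of the square roots, [d ^+ 4 <= (a - b) ^+ 2]; either
   [d <= eps], or [d <= d ^+ 4 / eps ^+ 3]. *)
exists (eps ^+ 3)^-1 => a b /andP[a0 _] /andP[b0 _].
rewrite !powR12_sqrt// -{2}(sqr_sqrtr a0) -{2}(sqr_sqrtr b0).
have := sqrtr_ge0 a; have := sqrtr_ge0 b.
move: (Num.sqrt a) (Num.sqrt b) => u v v0 u0.
have e30 : 0 < eps ^+ 3 by rewrite exprn_gt0.
have -> : (u ^+ 2 - v ^+ 2) ^+ 2 = (`|u - v| * (u + v)) ^+ 2.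
  by rewrite exprMn real_normK ?num_real//; ring.
have : `|u - v| <= u + v by rewrite ler_norml; apply/andP; split; lra.
move: (normr_ge0 (u - v)); set d := `|u - v| => d0 duv.
have [dle|edlt] := leP d eps.
  by rewrite (le_trans dle)// lerDl mulr_ge0 ?sqr_ge0// invr_ge0 ltW.
apply: le_trans (_ : (eps ^+ 3)^-1 * (d * d) ^+ 2 <= _); last first.
  rewrite (@le_trans _ _ ((eps ^+ 3)^-1 * (d * (u + v)) ^+ 2))//; last first.
    by rewrite lerDr ltW.
  rewrite ler_wpM2l ?invr_ge0 ?(ltW e30)//.
  have dd : d * d <= d * (u + v) by rewrite ler_wpM2l.
  by rewrite lerXn2r// nnegrE; [rewrite mulr_ge0|apply: le_trans dd; rewrite mulr_ge0].
rewrite mulrC ler_pdivlMr// -[_ ^+ 2]/(d * d * (d * d)) -mulrA ler_wpM2l//.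
have -> : d * (d * d) = d ^+ 3 by ring.
by rewrite lerXn2r ?nnegrE// ltW.
Qed.

Lemma powR_modulus s M eps : 1 <= s -> 0 < eps ->
  exists K, forall a b, 0 <= a <= M -> 0 <= b <= M ->
    `|a `^ s - b `^ s| <= eps + K * (a - b) ^+ 2.
Proof.
(* [L] is a Lipschitz constant on [[0, M]], and
   [L d <= eps + L ^+ 2 d ^+ 2 / (4 eps)] is the AM-GM inequality. *)
move=> s1 e0; pose L := s * M `^ (s - 1); exists (L ^+ 2 / (4 * eps)) => a b.
wlog ba : a b / b <= a => [H a0M b0M|].
  by have [/H->//|/ltW/H] := leP b a; rewrite distrC -(sqrrN (a - b)) opprB; exact.
move=> /andP[a0 aM] /andP[b0 bM].
have s0 : 0 < s by lra.
have ab : b `^ s <= a `^ s by apply: ge0_ler_powR; rewrite ?nnegrE// ltW.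
rewrite ger0_norm ?subr_ge0//.
have := powR_tangent s1 b0 a0; rewrite -(mulr_powRB1 a0 s0) => H.
have aL : s * a `^ (s - 1) <= L.
  rewrite ler_wpM2l ?(ltW s0)// ge0_ler_powR ?nnegrE//; first lra.
  exact: le_trans aM.
have d0 : 0 <= a - b by lra.
apply: (@le_trans _ _ (L * (a - b))).
  by apply: le_trans (ler_wpM2r d0 aL); lra.
have -> : eps + L ^+ 2 / (4 * eps) * (a - b) ^+ 2 =
    (L * (a - b)) + (2 * eps - L * (a - b)) ^+ 2 / (4 * eps).
  by field; exact: lt0r_neq0.
by rewrite lerDl divr_ge0 ?sqr_ge0//; lra.
Qed.

End Powers.

(** * The real inner product space underlying a Hilbert space *)

(** The discriminant of a nonnegative quadratic polynomial is nonpositive, also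
    in the degenerate case [p = 0].  All Cauchy-Schwarz inequalities, and the
    first-order condition at a minimum, are instances. *)
Lemma discr_le (R : realFieldType) (p q s : R) : 0 <= p ->
  (forall t : R, 0 <= p * t ^+ 2 + 2 * q * t + s) -> q ^+ 2 <= p * s.
Proof.
rewrite le_eqVlt => /predU1P[<-|p0] pos.
  rewrite mul0r; have [->|q0] := eqVneq q 0; first by rewrite expr0n.
  have := pos (- (s + 1) / (2 * q)).
  have -> : 0 * (- (s + 1) / (2 * q)) ^+ 2 + 2 * q * (- (s + 1) / (2 * q)) + s = -1.
    by field.
  lra.
have := pos (- q / p).
have -> : p * (- q / p) ^+ 2 + 2 * q * (- q / p) + s = (p * s - q ^+ 2) / p.
  by field; exact: lt0r_neq0.
by rewrite pmulr_lge0 ?invr_gt0// subr_ge0.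
Qed.

Lemma le_of_sqr_le (R : realFieldType) (a b : R) :
  0 <= a -> 0 <= b -> a ^+ 2 <= b * a -> a <= b.
Proof.
rewrite le_eqVlt => /predU1P[<-//|a0] _.
by rewrite expr2 ler_pM2r.
Qed.

Section HilbertSpace.
Local Open Scope complex_scope.
Context {R : realType} {H : hilbertType R}.
Implicit Types (x y z : H) (a : R) (c : R[i]).

(** The proof lives in the real Hilbert space underlying [H]: the forms of
    self-adjoint operators are real valued, and every inequality below compares
    real numbers. *)
Definition rdot x y : R := complex.Re (hdot x y).
Definition rnorm x : R := complex.Re `|x|.

Lemma hdotC x y : hdot y x = (hdot x y)^*.
Proof. by rewrite (@hermC _ _ (@Num.conj R[i]) _ (@hdot R H)) expr0 mul1r. Qed.

Lemma Re_conj c : complex.Re c^* = complex.Re c. Proof. by case: c. Qed.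

Lemma rdotC x y : rdot x y = rdot y x.
Proof. by rewrite /rdot hdotC Re_conj. Qed.

Lemma rdotDl x y z : rdot (x + y) z = rdot x z + rdot y z.
Proof. by rewrite /rdot linearDl raddfD. Qed.

Lemma rdotDr x y z : rdot z (x + y) = rdot z x + rdot z y.
Proof. by rewrite !(rdotC z) rdotDl. Qed.

Lemma rdotZl a x y : rdot (a%:C *: x) y = a * rdot x y.
Proof.
by rewrite /rdot linearZl_LR/=; case: (hdot x y) => u v /=; rewrite mul0r subr0.
Qed.

Lemma rdotZr a x y : rdot x (a%:C *: y) = a * rdot x y.
Proof. by rewrite rdotC rdotZl rdotC. Qed.

Lemma rdotNl x y : rdot (- x) y = - rdot x y.
Proof. by rewrite -scaleN1r -(rmorphN1 (real_complex R)) rdotZl mulN1r. Qed.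

Lemma rdotNr x y : rdot x (- y) = - rdot x y.
Proof. by rewrite rdotC rdotNl rdotC. Qed.

Lemma rdotBl x y z : rdot (x - y) z = rdot x z - rdot y z.
Proof. by rewrite rdotDl rdotNl. Qed.

Lemma rdotBr x y z : rdot z (x - y) = rdot z x - rdot z y.
Proof. by rewrite rdotDr rdotNr. Qed.

Lemma rdot0l x : rdot 0 x = 0.
Proof. by rewrite -(subrr x) rdotBl subrr. Qed.

Lemma rdot_suml (I : finType) (F : I -> H) x :
  rdot (\sum_i F i) x = \sum_i rdot (F i) x.
Proof.
by apply: (big_morph (rdot^~ x)) => [u v|]; rewrite ?rdotDl ?rdot0l.
Qed.

Lemma normE x : `|x| = (rnorm x)%:C.
Proof. by rewrite /rnorm RRe_real// ger0_real. Qed.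

Lemma rnorm_ge0 x : 0 <= rnorm x.
Proof. by rewrite -lecR -normE normr_ge0. Qed.

Lemma rdotxx x : rdot x x = rnorm x ^+ 2.
Proof. by rewrite /rdot hdot_normE normE -rmorphXn. Qed.

Lemma rdot_ge0 x : 0 <= rdot x x.
Proof. by rewrite rdotxx sqr_ge0. Qed.

Lemma rnormD x y : rnorm (x + y) <= rnorm x + rnorm y.
Proof. by rewrite -lecR rmorphD/= -!normE ler_normD. Qed.

Lemma rnormZ c x : rnorm (c *: x) = complex.Re `|c| * rnorm x.
Proof.
by rewrite {1}/rnorm normrZ normE; case: `|c| => u v /=; rewrite mulr0 subr0.
Qed.

Lemma rnormZr a x : rnorm (a%:C *: x) = `|a| * rnorm x.
Proof.
by rewrite rnormZ normc_def/= expr0n/= addr0 sqrtr_sqr.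
Qed.

Lemma rnormN x : rnorm (- x) = rnorm x.
Proof. by rewrite /rnorm normrN. Qed.

Lemma rnorm0 : rnorm 0 = 0 :> R. Proof. by rewrite /rnorm normr0. Qed.

Lemma rnorm_eq0 x : rnorm x = 0 -> x = 0.
Proof. by move=> x0; apply/eqP; rewrite -normr_eq0 normE x0. Qed.

Lemma rdot_CS x y : `|rdot x y| <= rnorm x * rnorm y.
Proof.
rewrite -(ler_pXn2r (_ : 0 < 2)%N) ?nnegrE ?mulr_ge0 ?rnorm_ge0//.
rewrite real_normK ?num_real// exprMn -!rdotxx.
apply: discr_le => [|t]; first exact: rdot_ge0.
have := rdot_ge0 (t%:C *: x + y).
by rewrite !(rdotDl, rdotDr, rdotZl, rdotZr) (rdotC y x); nra.
Qed.

Lemma norm_hdot_le x y : complex.Re `|hdot x y| <= (rnorm x ^+ 2 + rnorm y ^+ 2) / 2.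
Proof.
have [->|n0] := eqVneq (hdot x y) 0.
  by rewrite normr0/= divr_ge0// addr_ge0// sqr_ge0.
(* Rotating [x] by this phase makes the inner product real. *)
pose c := (hdot x y)^* / `|hdot x y|.
have nc : complex.Re `|c| = 1.
  rewrite /c normf_div normcJ.
  by rewrite normr_id divff ?normr_eq0.
have -> : complex.Re `|hdot x y| = rdot (c *: x) y.
  rewrite /rdot linearZl_LR/= /c mulrAC [_^* * _]mulrC -sqr_normc.
  by rewrite expr2 mulfK ?normr_eq0.
have := rdot_ge0 (c *: x - y).
rewrite !(rdotBl, rdotBr) (rdotC y) !rdotxx rnormZ nc mul1r; lra.
Qed.

End HilbertSpace.

(** * Coercive forms, adjoints and invertibility *)

Section Completeness.
Local Open Scope complex_scope.
Local Open Scope classical_set_scope.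
Context {R : realType} {H : hilbertType R}.

Lemma inv_small (e : R) : 0 < e ->
  exists N : nat, forall k, (N <= k)%N -> k.+1%:R^-1 <= e.
Proof.
move=> e0; exists (Num.Def.truncn e^-1) => k Nk.
rewrite invf_ple ?posrE ?ltr0n//; apply: ltW.
by rewrite (lt_le_trans (real_truncnS_gt _)) ?num_real// ler_nat ltnS.
Qed.

Lemma hilbert_complete (u : nat -> H) :
  (forall e : R, 0 < e -> exists N : nat, forall k l, (N <= k)%N -> (N <= l)%N ->
     rnorm (u k - u l) <= e) ->
  exists v, forall e : R, 0 < e -> exists N : nat, forall k, (N <= k)%N ->
     rnorm (u k - v) <= e.
Proof.
move=> uC.
have : cvg (u @ \oo).
  apply/cauchy_cvgP/cauchy_ballP => e e0; near_simpl.
  have Ree : (complex.Re e)%:C = e by rewrite RRe_real// gtr0_real.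
  have Re0 : 0 < complex.Re e by rewrite -ltcR Ree.
  have [N NP] := uC (complex.Re e / 2) (divr_gt0 Re0 (ltr0Sn _ 1)).
  exists ([set k | (N <= k)%N], [set k | (N <= k)%N]).
    by split; exists N.
  move=> [k l] [/= Nk Nl]; rewrite -ball_normE/= normE -Ree ltcR.
  by rewrite (le_lt_trans (NP _ _ Nk Nl))//; lra.
move=> /cvg_ex[v /cvgrPdistC_le uv]; exists v => e e0.
have [|N _ NP] := uv e%:C; first by rewrite ltcR.
by exists N => k Nk; have := NP k Nk; rewrite normE lecR.
Unshelve. all: by end_near. Qed.

End Completeness.

Section Operators.
Local Open Scope complex_scope.
Local Open Scope classical_set_scope.
Context {R : realType} {H : hilbertType R}.
Implicit Types (S T : 'B(H)) (x y v w : H).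

Lemma bop_bounded T : exists2 M : R, 0 <= M &
  forall x, rnorm (T x) <= M * rnorm x.
Proof.
have [_ [M TM]] := bopP T; exists (Num.max M 0); first by rewrite le_max lexx orbT.
move=> x; apply: (@le_trans _ _ (M * rnorm x)).
  by rewrite -lecR rmorphM/= -!normE.
by rewrite ler_wpM2r ?rnorm_ge0// le_max lexx.
Qed.

(** Stated for the real inner product; [hdot_of_rdot] recovers the complex
    identity. *)
Definition rselfadj T := forall x y, rdot (T x) y = rdot x (T y).

(** [rcoercive 0 T] is positivity of [T]. *)
Definition rcoercive (c : R) T := forall x, c * rnorm x ^+ 2 <= rdot (T x) x.

Lemma bop_suml (I : finType) (F : I -> 'B(H)) x :
  (\sum_i F i) x = \sum_i F i x.
Proof. by apply: (big_morph (fun T : 'B(H) => T x)). Qed.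

Lemma bop_add T x y : T (x + y) = T x + T y. Proof. exact: linearD. Qed.

Lemma bop_opp T x : T (- x) = - T x. Proof. exact: linearN. Qed.

Lemma bop_scale T c x : T (c *: x) = c *: T x. Proof. exact: linearZ. Qed.

(** The Riesz (Lax-Milgram) theorem for the form of a coercive self-adjoint
    operator, by the direct method: a minimising sequence of
    [J v = <S v, v> - 2 phi v] is Cauchy by the parallelogram identity, and
    the first-order condition at its limit is the claim.  With [S = 1] this is
    Riesz representation, hence adjoints; with [phi = <y, _>] it says that [S]
    is onto, hence invertibility. *)
Lemma coercive_riesz S (c M : R) (phi : H -> R) :
  rselfadj S -> 0 < c -> rcoercive c S ->
  (forall x y, phi (x + y) = phi x + phi y) ->
  (forall (a : R) x, phi (a%:C *: x) = a * phi x) ->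
  (forall x, `|phi x| <= M * rnorm x) ->
  exists v, forall w, phi w = rdot (S v) w.
Proof.
move=> Ssa c0 Sc phiD phiZ phiM.
pose J v := rdot (S v) v - 2 * phi v.
have Jlow v : - (M ^+ 2 / c) <= J v.
  have := Sc v; have := phiM v; rewrite /J ler_norml => /andP[_ h1 h2].
  have : 0 <= (c * rnorm v - M) ^+ 2 / c by rewrite divr_ge0 ?sqr_ge0// ltW.
  have -> : (c * rnorm v - M) ^+ 2 / c =
      c * rnorm v ^+ 2 - 2 * (M * rnorm v) + M ^+ 2 / c by field; exact: lt0r_neq0.
  lra.
have hasJ : has_inf (range J).
  by split; [exists (J 0), 0|exists (- (M ^+ 2 / c)) => _ [v _ <-]].
pose m := inf (range J).
have mJ v : m <= J v by apply: ge_inf; [exact: hasJ.2|exists v].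
have ex k : exists v, J v < m + k.+1%:R^-1.
  have [|_ [v _ <-] Jv] := @inf_adherent _ (range J) k.+1%:R^-1 _ hasJ.
    by rewrite invr_gt0 ltr0n.
  by exists v.
have [u uP] := choice ex.
have phiN x : phi (- x) = - phi x.
  by rewrite -scaleN1r -(rmorphN1 (real_complex R)) phiZ mulN1r.
have Jpar x y : J x + J y =
    2 * J ((2^-1)%:C *: (x + y)) + 2^-1 * rdot (S (x - y)) (x - y).
  rewrite /J !(bop_add, bop_opp, bop_scale).
  rewrite !(rdotZl, rdotZr, rdotDl, rdotDr, rdotNl, rdotNr, phiZ, phiD, phiN).
  by rewrite (Ssa y x) (rdotC y (S x)); field.
have uC k l : c / 2 * rnorm (u k - u l) ^+ 2 <= k.+1%:R^-1 + l.+1%:R^-1.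
  have := Jpar (u k) (u l); have := mJ ((2^-1)%:C *: (u k + u l)).
  have := Sc (u k - u l); have := uP k; have := uP l.
  by move: k.+1%:R^-1 l.+1%:R^-1 => ik il; lra.
have [|v vP] := @hilbert_complete R H u.
  move=> e e0; have ce0 : 0 < c / 4 * e ^+ 2 by rewrite mulr_gt0 ?exprn_gt0//; lra.
  have [N NP] := inv_small ce0; exists N => k l Nk Nl.
  rewrite -(ler_pXn2r (_ : 0 < 2)%N) ?nnegrE ?rnorm_ge0 ?(ltW e0)//.
  rewrite -(ler_pM2l (_ : 0 < c / 2)); last lra.
  have := uC k l; have := NP k Nk; have := NP l Nl.
  by move: k.+1%:R^-1 l.+1%:R^-1 => ik il; lra.
(* The minimality of [J] up to [k.+1%:R^-1] bounds the defect at [u k] through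
   [discr_le]; then [k] goes to infinity. *)
exists v => w; apply/eqP; rewrite eq_sym -subr_eq0 -sqrf_eq0 eq_le sqr_ge0 andbT.
set q := rdot (S w) w.
have q0 : 0 <= q by apply: le_trans (Sc w); rewrite mulr_ge0 ?sqr_ge0// ltW.
have Duk k : (rdot (S (u k)) w - phi w) ^+ 2 <= q * k.+1%:R^-1.
  apply: discr_le => // t; have := mJ (u k + t%:C *: w); have := uP k.
  rewrite /J !(bop_add, bop_scale) !(rdotZl, rdotZr, rdotDl, rdotDr, phiZ, phiD).
  rewrite (Ssa w (u k)) (rdotC w (S (u k))) -/q.
  by move: k.+1%:R^-1 => ik; lra.
have [B B0 SB] := bop_bounded S.
apply/ler_addgt0Pr => e e0; rewrite add0r.
pose L := 2 * (q + (B * rnorm w) ^+ 2 + 1).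
have BB0 : 0 <= (B * rnorm w) ^+ 2 by rewrite sqr_ge0.
have L0 : 0 < L by rewrite /L; lra.
pose d := Num.min 1 (e / L).
have d0 : 0 < d by rewrite lt_min ltr01 divr_gt0.
have d1 : d <= 1 by rewrite ge_min lexx.
have dL : d * L <= e by rewrite -ler_pdivlMr// ge_min lexx orbT.
have [N1 N1P] := inv_small d0; have [N2 N2P] := vP d d0.
pose k := maxn N1 N2.
have := Duk k; have := N1P k (leq_maxl _ _); have := N2P k (leq_maxr _ _).
move=> uv ik Dk.
have h1 : q * k.+1%:R^-1 <= q * d by rewrite ler_wpM2l.
have h2 : (rdot (S (u k)) w - rdot (S v) w) ^+ 2 <= (B * rnorm w) ^+ 2 * d.
  rewrite -rdotBl -bop_opp -bop_add -real_normK ?num_real//.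
  apply: (@le_trans _ _ ((B * rnorm w) ^+ 2 * d ^+ 2)).
    rewrite -exprMn lerXn2r ?nnegrE ?mulr_ge0 ?rnorm_ge0 ?(ltW d0)//.
    apply: le_trans (rdot_CS _ _) _.
    rewrite mulrAC ler_wpM2r ?rnorm_ge0//.
    by apply: le_trans (SB _) _; rewrite ler_wpM2l.
  by rewrite ler_wpM2l// expr2 -[leRHS]mulr1 ler_wpM2l// ltW.
move: Dk h2; set p := rdot (S (u k)) w; set p' := rdot (S v) w => Dk h2.
have : 0 <= (p - phi w + (p - p')) ^+ 2 by rewrite sqr_ge0.
have : L * d = 2 * (q * d) + 2 * ((B * rnorm w) ^+ 2 * d) + 2 * d by rewrite /L; ring.
move: (le_trans Dk h1) dL d0 h2; rewrite [d * L]mulrC.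
move: (L * d) (q * d) ((B * rnorm w) ^+ 2 * d) => Ld qd z.
have -> : (p' - phi w) ^+ 2 = 2 * (p - phi w) ^+ 2 + 2 * (p - p') ^+ 2 -
  (p - phi w + (p - p')) ^+ 2 by ring.
lra.
Qed.

End Operators.

Section Adjoint.
Local Open Scope complex_scope.
Local Open Scope classical_set_scope.
Context {R : realType} {H : hilbertType R}.
Implicit Types (S T : 'B(H)) (x y z v w : H).

Lemma rdot_inj u v : (forall x : H, rdot x u = rdot x v) -> u = v.
Proof.
move=> uv; apply/eqP; rewrite -subr_eq0; apply/eqP/rnorm_eq0/eqP.
by rewrite -sqrf_eq0 -rdotxx rdotBr uv subrr.
Qed.

(** A complex number is determined by its real part and that of its product
    with ['i], so the identity for [x] and ['i *: x] is enough. *)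
Lemma hdot_of_rdot T (f : H -> H) :
  (forall x y, rdot (T x) y = rdot x (f y)) ->
  forall x y, hdot (T x) y = hdot x (f y).
Proof.
move=> Tf x y; have := Tf x y; have := Tf ('i *: x) y.
rewrite bop_scale /rdot !linearZl_LR/=.
case: (hdot (T x) y) (hdot x (f y)) => [a b] [c d] /=.
by rewrite !mul0r !mul1r !sub0r => /oppr_inj -> ->.
Qed.

Lemma hdot_inj u v : (forall x : H, hdot x u = hdot x v) -> u = v.
Proof. by move=> uv; apply: rdot_inj => x; rewrite /rdot uv. Qed.

Lemma mk_bop (f : H -> H) (M : R) : linear f ->
  (forall x, rnorm (f x) <= M * rnorm x) -> exists F : 'B(H), forall x, F x = f x.
Proof.
move=> fl fM; have bf : f \in @bounded_op R H.
  apply/asboolP; split => //; exists M => x.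
  by rewrite !normE -rmorphM lecR.
by exists (Bop bf).
Qed.

Lemma adjoint_exists T :
  exists S : 'B(H), forall x y, hdot (T x) y = hdot x (S y).
Proof.
have [M M0 TM] := bop_bounded T.
have ex y : exists v, forall x, rdot (T x) y = rdot v x.
  apply: (@coercive_riesz R H 1 1 (M * rnorm y)) => //.
  - by move=> x; rewrite mul1r rdotxx.
  - by move=> x z; rewrite bop_add rdotDl.
  - by move=> a x; rewrite bop_scale rdotZl.
  - move=> x; apply: le_trans (rdot_CS _ _) _.
    by rewrite mulrAC ler_wpM2r ?rnorm_ge0.
have [f fP] := choice ex.
have fE x y : hdot (T x) y = hdot x (f y).
  by apply: hdot_of_rdot => {}x {}y; rewrite fP rdotC.
have flin : linear f.
  move=> a y z; apply: hdot_inj => x.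
  by rewrite -fE !linearDr !linearZr_LR/= !fE.
have fM y : rnorm (f y) <= M * rnorm y.
  apply: le_of_sqr_le; rewrite ?mulr_ge0 ?rnorm_ge0//.
  rewrite -rdotxx -fP (le_trans (ler_norm _))// (le_trans (rdot_CS _ _))//.
  by rewrite mulrAC ler_wpM2r ?rnorm_ge0.
by have [S SE] := mk_bop flin fM; exists S => x y; rewrite SE.
Qed.

Lemma adjointP T x y : hdot (T x) y = hdot x (adjoint T y).
Proof. by have := xgetPex 0 (adjoint_exists T); exact. Qed.

Lemma rdot_adjoint T x y : rdot (T x) y = rdot x (adjoint T y).
Proof. by rewrite /rdot adjointP. Qed.

Lemma opnorm_ubound T : exists M : R, ubound
  [set complex.Re `|T x| | x in [set x : H | `|x| <= 1]] M.
Proof.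
have [M M0 TM] := bop_bounded T; exists M => _ [x /= x1 <-].
apply: le_trans (TM x) _; rewrite -[leRHS]mulr1 ler_wpM2l//.
by rewrite -lecR -normE.
Qed.

Lemma rnorm_opnorm T x : rnorm (T x) <= opnorm T * rnorm x.
Proof.
have := rnorm_ge0 x; rewrite le_eqVlt => /predU1P[x0|x0].
  have -> : x = 0 by apply: rnorm_eq0.
  by rewrite (linear0 T) rnorm0 mulr0.
rewrite -ler_pdivrMr// mulrC.
have -> : (rnorm x)^-1 * rnorm (T x) = rnorm (T ((rnorm x)^-1%:C *: x)).
  by rewrite bop_scale rnormZr ger0_norm// invr_ge0 ltW.
apply: ub_le_sup; first exact: opnorm_ubound.
exists ((rnorm x)^-1%:C *: x) => //=.
by rewrite normE lecR rnormZr ger0_norm ?invr_ge0 ?(ltW x0)// mulVf// gt_eqF.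
Qed.

Lemma opnorm_ge0 T : 0 <= opnorm T.
Proof.
apply: ub_le_sup; first exact: opnorm_ubound.
by exists 0; rewrite /= ?normr0// (linear0 T) normr0.
Qed.

Lemma opnorm_le T (e : R) : 0 <= e -> (forall x, rnorm (T x) <= e * rnorm x) ->
  opnorm T <= e.
Proof.
move=> e0 Te; apply: ge_sup.
  by exists 0, 0; rewrite /= ?normr0// (linear0 T) normr0.
move=> _ [x /= x1 <-]; apply: le_trans (Te x) _.
by rewrite -[leRHS]mulr1 ler_wpM2l// -lecR -normE.
Qed.

Lemma quad_bounded T : exists2 M : R, 0 < M &
  forall x, rdot (T x) x <= M * rnorm x ^+ 2.
Proof.
have [M M0 TM] := bop_bounded T; exists (M + 1) => [|x]; first lra.
apply: le_trans (ler_norm _) _; apply: le_trans (rdot_CS _ _) _.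
rewrite expr2 mulrA ler_wpM2r ?rnorm_ge0//.
by apply: le_trans (TM x) _; rewrite ler_wpM2r ?rnorm_ge0//; lra.
Qed.

Lemma coercive_invertible S (c : R) : rselfadj S -> 0 < c -> rcoercive c S ->
  exists S' : 'B(H), S' * S = 1 /\ S * S' = 1.
Proof.
move=> Ssa c0 Sc.
have ex y : exists v, S v = y.
  have [|||v vP] := @coercive_riesz R H S c (rnorm y) (rdot y) Ssa c0 Sc.
  - by move=> u v; rewrite rdotDr.
  - by move=> a v; rewrite rdotZr.
  - exact: rdot_CS.
  by exists v; apply: rdot_inj => x; rewrite !(rdotC x) vP.
have [g gP] := choice ex.
have Sinj u v : S u = S v -> u = v.
  move=> uv; apply/eqP; rewrite -subr_eq0; apply/eqP/rnorm_eq0/eqP.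
  rewrite -sqrf_eq0 eq_le sqr_ge0 andbT -(ler_pM2l c0) mulr0.
  by apply: le_trans (Sc _) _; rewrite bop_add bop_opp uv subrr rdot0l.
have glin : linear g.
  by move=> a y z; apply: Sinj; rewrite bop_add bop_scale !gP.
have gM y : rnorm (g y) <= c^-1 * rnorm y.
  apply: le_of_sqr_le; rewrite ?mulr_ge0 ?rnorm_ge0 ?invr_ge0 ?(ltW c0)//.
  rewrite -mulrA -(ler_pM2l c0) mulVKf ?gt_eqF//.
  by rewrite (le_trans (Sc _))// gP (le_trans (ler_norm _))// rdot_CS.
have [S' S'E] := mk_bop glin gM; exists S'.
split; apply: bop_ext => x; rewrite -[RHS]/x.
  by rewrite -[LHS]/(S' (S x)) S'E; apply: Sinj; rewrite gP.
by rewrite -[LHS]/(S (S' x)) S'E gP.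
Qed.

(** Below [0] or above [M], one of [T - t] and [t - T] is coercive. *)
Lemma spectrum_bounds T (M t : R) : rselfadj T -> rcoercive 0 T ->
  (forall x, rdot (T x) x <= M * rnorm x ^+ 2) -> spectrum T t%:C ->
  0 <= t <= M.
Proof.
move=> Tsa T0 TM st; apply/andP; split; rewrite leNgt; apply/negP => tlt; apply: st.
  apply: (@coercive_invertible _ (- t)); rewrite ?oppr_gt0//.
    move=> x y; rewrite -[X in rdot X _]/(T x - t%:C *: x).
    by rewrite -[X in _ = rdot _ X]/(T y - t%:C *: y) rdotBl rdotBr rdotZl rdotZr Tsa.
  move=> x; rewrite -[X in rdot X _]/(T x - t%:C *: x) rdotBl rdotZl rdotxx.
  by have := T0 x; lra.
have [|||S' [S'l S'r]] := @coercive_invertible (t%:C *: (1 : 'B(H)) - T) (t - M).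
- move=> x y; rewrite -[X in rdot X _]/(t%:C *: x - T x).
  by rewrite -[X in _ = rdot _ X]/(t%:C *: y - T y) rdotBl rdotBr rdotZl rdotZr Tsa.
- by rewrite subr_gt0.
- move=> x; rewrite -[X in rdot X _]/(t%:C *: x - T x) rdotBl rdotZl rdotxx.
  by have := TM x; lra.
exists (- S'); rewrite -opprB.
by rewrite !mulNr !mulrN !opprK.
Qed.

End Adjoint.

(** * Polynomials of a self-adjoint operator *)

Section PolynomialCalculus.
Local Open Scope complex_scope.
Local Open Scope classical_set_scope.
Context {R : realType} {H : hilbertType R}.
Implicit Types (S T : 'B(H)) (x y z v w : H) (q : {poly R[i]}) (p : {poly R}).

Lemma bop_scaleAl c S T : (c *: S) * T = c *: (S * T).
Proof. exact: bop_ext. Qed.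

Lemma bop_scaleAr c S T : S * (c *: T) = c *: (S * T).
Proof. by apply: bop_ext => x; rewrite -[LHS]/(S (c *: T x)) bop_scale. Qed.

(** [peval] with complex coefficients, over which polynomials split. *)
Definition cpeval q T : 'B(H) := \sum_(k < size q) q`_k *: T ^+ k.

Lemma cpeval_widen n q T : (size q <= n)%N ->
  cpeval q T = \sum_(k < n) q`_k *: T ^+ k.
Proof.
move=> qn; rewrite /cpeval -(subnKC qn) big_split_ord/=.
rewrite [X in _ = _ + X]big1 ?addr0// => k _.
by rewrite nth_default ?leq_addr// scale0r.
Qed.

Lemma cpevalD q q' T : cpeval (q + q') T = cpeval q T + cpeval q' T.
Proof.
have n1 := leq_maxl (size q) (size q'); have n2 := leq_maxr (size q) (size q').
rewrite (cpeval_widen _ (size_polyD _ _)) (cpeval_widen _ n1) (cpeval_widen _ n2).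
by rewrite -big_split/=; apply: eq_bigr => k _; rewrite coefD scalerDl.
Qed.

Lemma cpevalC c T : cpeval c%:P T = c *: (1 : 'B(H)).
Proof.
rewrite (cpeval_widen _ (size_polyC_leq1 c)) big_ord_recl big_ord0 addr0.
by rewrite coefC eqxx expr0.
Qed.

Lemma cpevalMX q T : cpeval (q * 'X) T = cpeval q T * T.
Proof.
have sX : (size (q * 'X)%R <= (size q).+1)%N.
  by rewrite (leq_trans (size_polyMleq _ _))// size_polyX addn2.
rewrite (cpeval_widen _ sX) big_ord_recl coefMX eqxx scale0r add0r mulr_suml.
by apply: eq_bigr => k _; rewrite coefMX/= exprSr bop_scaleAl.
Qed.

Lemma cpevalM q q' T : cpeval (q * q') T = cpeval q T * cpeval q' T.
Proof.
elim/poly_ind: q' => [|q' c IH].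
  by rewrite mulr0 -[0]/(0%:P) cpevalC scale0r mulr0.
have cC r : cpeval (r * c%:P) T = cpeval r T * (c *: (1 : 'B(H))).
  rewrite bop_scaleAr mulr1.
  have sC : (size (r * c%:P)%R <= size r)%N.
    rewrite (leq_trans (size_polyMleq _ _))//.
    by have := size_polyC_leq1 c; lia.
  rewrite (cpeval_widen _ sC) /cpeval scaler_sumr.
  by apply: eq_bigr => k _; rewrite coefMC scalerA mulrC.
by rewrite mulrDr cpevalD mulrA cpevalMX IH cC cpevalD cpevalMX cpevalC mulrDr mulrA.
Qed.

Lemma peval_cpeval p T : peval p T = cpeval (map_poly (real_complex R) p) T.
Proof.
rewrite /peval /cpeval size_map_poly.
by apply: eq_bigr => k _; rewrite coef_map.
Qed.

Lemma pevalD p p' T : peval (p + p') T = peval p T + peval p' T.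
Proof. by rewrite !peval_cpeval rmorphD cpevalD. Qed.

Lemma pevalM p p' T : peval (p * p') T = peval p T * peval p' T.
Proof. by rewrite !peval_cpeval rmorphM cpevalM. Qed.

Lemma pevalC (a : R) T : peval a%:P T = a%:C *: (1 : 'B(H)).
Proof. by rewrite peval_cpeval map_polyC cpevalC. Qed.

Lemma pevalX T : peval 'X T = T.
Proof.
by rewrite peval_cpeval map_polyX -['X]mul1r cpevalMX cpevalC scale1r mul1r.
Qed.

Lemma pevalN p T : peval (- p) T = - peval p T.
Proof.
by rewrite -mulN1r -polyCN pevalM pevalC rmorphN1 scaleN1r mulNr mul1r.
Qed.

Lemma pevalB p p' T : peval (p - p') T = peval p T - peval p' T.
Proof. by rewrite pevalD pevalN. Qed.

Lemma rselfadj_peval p T : rselfadj T -> rselfadj (peval p T).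
Proof.
move=> Tsa; elim/poly_ind: p => [|p c IH] x y.
  by rewrite -[0]/(0%:P) pevalC scale0r rdot0l rdotC rdot0l.
rewrite pevalD pevalM pevalX pevalC.
rewrite -[X in rdot X _]/(peval p T (T x) + c%:C *: x).
have -> : (peval p T * T + c%:C *: (1 : 'B(H))) y = T (peval p T y) + c%:C *: y.
  rewrite -[LHS]/(peval p T (T y) + c%:C *: y); congr (_ + _).
  have : peval p T * T = T * peval p T.
    by rewrite -{2 3}(pevalX T) -!pevalM mulrC.
  by move=> /(congr1 (fun U : 'B(H) => U y)).
by rewrite rdotDl rdotDr IH Tsa rdotZl rdotZr.
Qed.

(** For spectral arguments this replaces invertibility: it passes to products
    directly and holds at nonreal points without solving an equation. *)
Definition bounded_below T :=
  exists2 c : R, 0 < c & forall x, c * rnorm x <= rnorm (T x).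

Lemma bounded_belowM S T :
  bounded_below S -> bounded_below T -> bounded_below (S * T).
Proof.
move=> [c c0 Sc] [d d0 Td]; exists (c * d); first exact: mulr_gt0.
move=> x; apply: le_trans (Sc (T x)).
by rewrite -mulrA ler_pM2l.
Qed.

Lemma bounded_below_invertible S T : S * T = 1 -> bounded_below T.
Proof.
move=> ST; have [M M0 SM] := bop_bounded S.
have M1 : 0 < M + 1 by lra.
exists (M + 1)^-1; first by rewrite invr_gt0.
move=> x; rewrite ler_pdivrMl//.
have /(congr1 (fun U : 'B(H) => U x)) STx := ST.
rewrite -{1}[x]/((1 : 'B(H)) x) -STx (le_trans (SM _))//.
by rewrite ler_wpM2r ?rnorm_ge0//; lra.
Qed.

(** At a nonreal [c = a + b i] the two parts [(T - a) x] and [b i x] of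
    [(T - c) x] are orthogonal for the real inner product, because [<S x, x>]
    is real for self-adjoint [S]; so [`|b|] is a lower bound. *)
Lemma bounded_below_sub_nonspectral T c : rselfadj T ->
  (forall t : R, c = t%:C -> ~ spectrum T t%:C) ->
  bounded_below (T - c *: (1 : 'B(H))).
Proof.
move=> Tsa; case: c => a b cT.
have [b0|b0] := eqVneq b 0.
  move: cT; rewrite b0 => /(_ a erefl)/contrapT[S [ST _]].
  exact: bounded_below_invertible ST.
have iT S x : rselfadj S -> rdot (S x) ('i *: x) = 0.
  move=> Ssa; have := Ssa x ('i *: x); rewrite bop_scale.
  rewrite (rdotC x) /rdot linearZr_LR linearZl_LR/=.
  by case: (hdot (S x) x) => u v /=; lra.
exists `|b|; first by rewrite normr_gt0.
move=> x; rewrite -(ler_pXn2r (_ : 0 < 2)%N) ?nnegrE ?mulr_ge0 ?rnorm_ge0//.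
rewrite exprMn real_normK ?num_real// -!rdotxx.
have -> : (T - (a +i* b) *: (1 : 'B(H))) x = T x - a%:C *: x - b%:C *: ('i *: x).
  rewrite -[LHS]/(T x - (a +i* b) *: x) [a +i* b]complexE scalerDl opprD addrA.
  by rewrite mulrC scalerA.
have ii : rdot ('i *: x) ('i *: x) = rdot x x.
  by rewrite !rdotxx rnormZ normc_def/= expr0n expr1n add0r sqrtr1 mul1r.
have := iT T x Tsa; have := iT 1 x (fun _ _ => erefl).
rewrite -[(1 : 'B(H)) x]/x => i1 i2.
have := rdot_ge0 (T x - a%:C *: x).
set u := T x - _; have ui : rdot u ('i *: x) = 0.
  by rewrite /u rdotBl rdotZl i1 i2 mulr0 subr0.
move: u ui => u ui u0.
rewrite !(rdotBl, rdotBr, rdotZl, rdotZr) (rdotC _ u) ui ii.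
by rewrite mulr0 subr0 sub0r opprK mulrA -expr2 lerDr.
Qed.

(** The spectral mapping theorem in the form needed: split [q] into linear
    factors and bound each of them below. *)
Lemma bounded_below_cpeval q T : rselfadj T -> q != 0 ->
  (forall t : R, spectrum T t%:C -> ~~ root q t%:C) ->
  bounded_below (cpeval q T).
Proof.
move=> Tsa q0; have [rs qE] := closed_field_poly_normal q.
have lq0 : lead_coef q != 0 by rewrite lead_coef_eq0.
move=> rootq; have {}rootq t : spectrum T t%:C -> t%:C \notin rs.
  by move=> /rootq; rewrite qE rootZ// root_prod_XsubC.
rewrite qE -mul_polyC cpevalM; apply: bounded_belowM.
  apply: (@bounded_below_invertible ((lead_coef q)^-1 *: (1 : 'B(H)))).
  by rewrite cpevalC bop_scaleAl mul1r scalerA mulVf// scale1r.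
elim: rs rootq {qE} => [|c rs IH] rootq.
  rewrite big_nil -[1]/(1%:P) cpevalC scale1r.
  by exists 1 => // x; rewrite mul1r.
rewrite big_cons cpevalM; apply: bounded_belowM; last first.
  by apply: IH => t /rootq; rewrite inE negb_or => /andP[].
rewrite -['X]mul1r -polyCN cpevalD cpevalMX !cpevalC scale1r mul1r scaleNr.
apply: bounded_below_sub_nonspectral => // t ct /rootq.
by rewrite inE ct eqxx.
Qed.

Lemma rdot_form_CS S x y : rselfadj S -> rcoercive 0 S ->
  rdot (S x) y ^+ 2 <= rdot (S x) x * rdot (S y) y.
Proof.
move=> Ssa S0; have S0' z : 0 <= rdot (S z) z by have := S0 z; rewrite mul0r.
apply: discr_le => // t; have := S0' (t%:C *: x + y).
rewrite bop_add bop_scale !(rdotDl, rdotDr, rdotZl, rdotZr).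
by rewrite (Ssa y x) (rdotC y (S x)); lra.
Qed.

(** The infimum [m] of the numerical range is an approximate eigenvalue.  With
    [P = S - m >= 0] and [D] a bound of [P], Cauchy-Schwarz for the form of [P] gives
    [`|P x| ^ 2 <= (D + 1) <P x, x>], so a lower bound for [P] would keep
    [<S x, x>] away from [m] on the unit sphere. *)
Lemma numrange_inf S x0 : rselfadj S -> rnorm x0 = 1 ->
  exists2 m : R, m <= rdot (S x0) x0 & ~ bounded_below (S - m%:C *: (1 : 'B(H))).
Proof.
move=> Ssa x01; pose E := [set rdot (S x) x | x in [set x | rnorm x = 1]].
have [B B0 SB] := bop_bounded S.
have hasE : has_inf E.
  split; first by exists (rdot (S x0) x0), x0.
  exists (- B) => _ [x /= x1 <-].
  have := rdot_CS (S x) x; have := SB x; rewrite x1 !mulr1 ler_norml => ? /andP[? _].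
  lra.
have Einf x : rnorm x = 1 -> inf E <= rdot (S x) x.
  by move=> x1; apply: ge_inf; [exact: hasE.2|exists x].
exists (inf E) => [|[c c0 bb]]; first exact: Einf.
set m := inf E in Einf bb.
set P := S - _ in bb.
have PE x : P x = S x - m%:C *: x by [].
have Psa : rselfadj P.
  by move=> x y; rewrite !PE rdotBl rdotBr rdotZl rdotZr Ssa.
have P0 : rcoercive 0 P.
  move=> x; rewrite mul0r PE rdotBl rdotZl rdotxx.
  have := rnorm_ge0 x; rewrite le_eqVlt => /predU1P[/esym x0'|x0'].
    by rewrite x0' (rnorm_eq0 x0') (linear0 S) rdot0l expr0n mulr0 subr0.
  have := Einf ((rnorm x)^-1%:C *: x).
  rewrite rnormZr ger0_norm ?invr_ge0 ?(ltW x0')// mulVf ?gt_eqF// => /(_ erefl).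
  rewrite bop_scale rdotZl rdotZr => h; rewrite subr_ge0.
  have -> : rdot (S x) x =
      (rnorm x)^-1 * ((rnorm x)^-1 * rdot (S x) x) * rnorm x ^+ 2.
    by field; exact: lt0r_neq0.
  by rewrite ler_wpM2r ?sqr_ge0.
have [D D0 PD] := bop_bounded P.
have D1 : 0 < D + 1 by lra.
have P2 x : rnorm (P x) ^+ 2 <= (D + 1) * rdot (P x) x.
  have pp : 0 <= rdot (P x) x by have := P0 x; rewrite mul0r.
  have := rnorm_ge0 (P x); rewrite le_eqVlt => /predU1P[<-|px0].
    by rewrite expr0n mulr_ge0// ltW.
  have := rdot_form_CS x (P x) Psa P0; rewrite rdotxx => h.
  have h2 : rdot (P (P x)) (P x) <= (D + 1) * rnorm (P x) ^+ 2.
    apply: le_trans (ler_norm _) _; apply: le_trans (rdot_CS _ _) _.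
    rewrite expr2 mulrA ler_wpM2r ?rnorm_ge0//.
    by apply: le_trans (PD _) _; rewrite ler_wpM2r ?rnorm_ge0//; lra.
  rewrite -(ler_pM2r (exprn_gt0 2 px0)) -expr2 (le_trans h)//.
  by rewrite -mulrA mulrCA ler_wpM2l.
have : m + c ^+ 2 / (D + 1) <= m.
  apply: lb_le_inf hasE.1 _ => _ [x /= x1 <-].
  have := P2 x; have := bb x; rewrite x1 mulr1.
  rewrite PE rdotBl rdotZl rdotxx x1 expr1n mulr1 -PE.
  move=> h1 h2; rewrite addrC -lerBrDr ler_pdivrMr// mulrC (le_trans _ h2)//.
  by rewrite lerXn2r ?nnegrE ?rnorm_ge0// ltW.
have : 0 < c ^+ 2 / (D + 1) by rewrite divr_gt0// exprn_gt0.
by move: (_ / _) => d; lra.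
Qed.

Lemma spectral_root T q : rselfadj T -> q != 0 -> ~ bounded_below (cpeval q T) ->
  exists2 t : R, spectrum T t%:C & root q t%:C.
Proof.
move=> Tsa q0 nbb; apply: contrapT => noroot; apply: nbb.
apply: bounded_below_cpeval => // t st; apply/negP => rt; apply: noroot.
by exists t.
Qed.

Lemma spectrum_nonempty T x0 : rselfadj T -> rnorm x0 = 1 ->
  exists t : R, spectrum T t%:C.
Proof.
move=> Tsa x01; have [m _ nbb] := numrange_inf Tsa x01.
have [||t st _] := @spectral_root T ('X - (m%:C)%:P) Tsa.
- by rewrite polyXsubC_eq0.
- by rewrite -['X]mul1r -polyCN cpevalD cpevalMX !cpevalC scale1r mul1r scaleNr.
by exists t.
Qed.

(** Positivity of the calculus: the infimum [m] of the numerical range of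
    [p(T)] is a value of [p] on the spectrum, as [p(T) - m] is not bounded
    below.  When [p] is the constant [m] there is no root to pick, and the
    nonemptiness of the spectrum is used instead. *)
Lemma peval_ge0 T p : rselfadj T ->
  (forall t : R, spectrum T t%:C -> 0 <= p.[t]) -> rcoercive 0 (peval p T).
Proof.
move=> Tsa p0 x; rewrite mul0r leNgt; apply/negP => px.
have x0 : 0 < rnorm x.
  rewrite lt_def rnorm_ge0 andbT; apply/eqP => /rnorm_eq0 x0.
  by move: px; rewrite x0 (linear0 (peval p T)) rdot0l ltxx.
pose y := (rnorm x)^-1%:C *: x.
have y1 : rnorm y = 1.
  by rewrite rnormZr ger0_norm ?invr_ge0 ?(ltW x0)// mulVf// gt_eqF.
have py : rdot (peval p T y) y < 0.
  by rewrite bop_scale rdotZl rdotZr !pmulr_rlt0 ?invr_gt0.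
have [m mpy nbb] := numrange_inf (rselfadj_peval p Tsa) y1.
have m0 : m < 0 by apply: le_lt_trans py.
have [pm|pm] := eqVneq (p - m%:P) 0.
  have [t /p0] := spectrum_nonempty Tsa y1.
  by move/eqP: pm; rewrite subr_eq0 => /eqP ->; rewrite hornerC leNgt m0.
have [||t /p0 pt] := @spectral_root T (map_poly (real_complex R) (p - m%:P)) Tsa.
- by rewrite map_poly_eq0.
- by rewrite -peval_cpeval pevalB pevalC.
by rewrite fmorph_root /root !hornerE => /eqP; lra.
Qed.

(** Positivity of [e ^+ 2 - p ^+ 2] on the spectrum. *)
Lemma rnorm_peval T p (e : R) x : rselfadj T -> 0 <= e ->
  (forall t : R, spectrum T t%:C -> `|p.[t]| <= e) ->
  rnorm (peval p T x) <= e * rnorm x.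
Proof.
move=> Tsa e0 pe.
rewrite -(ler_pXn2r (_ : 0 < 2)%N) ?nnegrE ?mulr_ge0 ?rnorm_ge0//.
have := @peval_ge0 T ((e ^+ 2)%:P - p * p) Tsa.
have h t : spectrum T t%:C -> 0 <= ((e ^+ 2)%:P - p * p).[t].
  move=> /pe pte; rewrite !hornerE subr_ge0 -expr2 -real_normK ?num_real//.
  by rewrite lerXn2r ?nnegrE.
move=> /(_ h x); rewrite mul0r pevalB pevalM pevalC.
rewrite -[X in rdot X _]/((e ^+ 2)%:C *: x - peval p T (peval p T x)).
rewrite rdotBl rdotZl (rselfadj_peval p Tsa (peval p T x)) !rdotxx exprMn; lra.
Qed.

End PolynomialCalculus.

(** * Continuous functional calculus of positive operators *)

Section FunctionalCalculus.
Local Open Scope complex_scope.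
Local Open Scope classical_set_scope.
Context {R : realType} {H : hilbertType R}.
Implicit Types (S T F X : 'B(H)) (x y z v w : H) (p q : {poly R}) (f : R -> R).

Lemma le_of_small (a b K : R) : 0 <= K ->
  (forall e, 0 < e -> e <= 1 -> a <= b + e * K) -> a <= b.
Proof.
move=> K0 small; apply/ler_addgt0Pr => e e0.
have K1 : 0 < K + 1 by lra.
pose d := Num.min 1 (e / (K + 1)).
have d0 : 0 < d by rewrite lt_min ltr01 divr_gt0.
have := small d d0; rewrite {1}/d ge_min lexx => /(_ isT) h.
have : d * (K + 1) <= e by rewrite -ler_pdivlMr// ge_min lexx orbT.
move: d d0 h => d d0 h; nra.
Qed.

(** The defining property of [fun_calc f T], with the sequence of polynomials
    replaced by one polynomial for each precision. *)
Definition is_calc f T F := forall e : R, 0 < e -> exists2 p : {poly R},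
  forall t : R, spectrum T t%:C -> `|p.[t] - f t| <= e &
  forall x, rnorm (peval p T x - F x) <= e * rnorm x.

Lemma peval_dist T p q (e : R) x : rselfadj T -> 0 <= e ->
  (forall t : R, spectrum T t%:C -> `|p.[t] - q.[t]| <= e) ->
  rnorm (peval p T x - peval q T x) <= e * rnorm x.
Proof.
move=> Tsa e0 pq; rewrite -[X in rnorm X]/((peval p T - peval q T) x) -pevalB.
by apply: rnorm_peval => // t /pq; rewrite hornerD hornerN.
Qed.

Lemma uniform_polyP f T (p : nat -> {poly R}) :
  {uniform [set t : R | spectrum T t%:C],
    (fun k t => (p k).[t]) @ \oo --> f} <->
  (forall e, 0 < e -> \forall k \near \oo,
     forall t : R, spectrum T t%:C -> `|f t - (p k).[t]| < e).
Proof.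
split=> [pf e e0|pf P /uniform_nbhs[E [entE EP]]].
  apply: (pf [set h | forall t : R, spectrum T t%:C -> `|f t - h t| < e]).
  apply/uniform_nbhs; exists [set xy | ball xy.1 e xy.2]; split.
    exact: entourage_ball (PosNum e0).
  by move=> h.
have [e e0 eE] : exists2 e : R, 0 < e & [set xy | ball xy.1 e xy.2] `<=` E.
  by move: entE; rewrite -entourage_ballE => -[e /= e0 eE]; exists e.
have := pf e e0; apply: filterS => k pk; apply: EP => t st; apply: eE.
exact: pk.
Qed.

(** Completeness of the space of operators, for the sequences at hand: pointwise
    limits exist, inherit the rate, and the rate makes them linear and
    bounded. *)
Lemma peval_limit T (p : nat -> {poly R}) : rselfadj T ->
  (forall k l x, rnorm (peval (p k) T x - peval (p l) T x) <=
     (k.+1%:R^-1 + l.+1%:R^-1) * rnorm x) ->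
  exists F : 'B(H), forall k x,
    rnorm (peval (p k) T x - F x) <= k.+1%:R^-1 * rnorm x.
Proof.
move=> Tsa pC.
have i0 k : 0 < k.+1%:R^-1 :> R by rewrite invr_gt0 ltr0n.
have ex x : exists v, forall k, rnorm (peval (p k) T x - v) <= k.+1%:R^-1 * rnorm x.
  have x0 := rnorm_ge0 x.
  have [|v vP] := @hilbert_complete R H (fun k => peval (p k) T x).
    move=> e e0; have d0 : 0 < e / (2 * (rnorm x + 1)).
      by rewrite divr_gt0// mulr_gt0//; lra.
    have [N NP] := inv_small d0; exists N => k l /NP Nk /NP Nl.
    apply: le_trans (pC k l x) _.
    apply: (@le_trans _ _ (2 * (e / (2 * (rnorm x + 1))) * (rnorm x + 1))).
      apply: ler_pM => //; last lra.
      by move: k.+1%:R^-1 l.+1%:R^-1 Nk Nl => ik il; move: (_ / _) => d; lra.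
    rewrite le_eqVlt; apply/orP; left; apply/eqP; field.
    by rewrite gt_eqF//; lra.
  exists v => k; apply: (@le_of_small _ _ (rnorm x + 1)); first lra.
  move=> e e0 _; have [N1 N1P] := inv_small e0; have [N2 N2P] := vP e e0.
  have := N1P _ (leq_maxl N1 N2); have := N2P _ (leq_maxr N1 N2).
  set l := maxn N1 N2 => h1 h2; have := pC k l x.
  have := rnormD (peval (p k) T x - peval (p l) T x) (peval (p l) T x - v).
  rewrite addrA subrK => h3 h4.
  have h5 : l.+1%:R^-1 * rnorm x <= e * rnorm x by rewrite ler_wpM2r.
  move: h4; rewrite mulrDl => h4.
  move: (k.+1%:R^-1 * rnorm x) (l.+1%:R^-1 * rnorm x) h4 h5 => a b h4 h5; lra.
have [g gP] := choice ex.
have glin : linear g.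
  move=> a y z; apply/eqP; rewrite -subr_eq0; apply/eqP/rnorm_eq0/eqP.
  rewrite eq_le rnorm_ge0 andbT.
  pose K := rnorm (a *: y + z) + (complex.Re `|a| * rnorm y + rnorm z).
  have a0 : 0 <= complex.Re `|a|.
    by rewrite -lecR RRe_real ?normr_real//; exact: normr_ge0.
  apply: (@le_of_small _ _ K).
    by rewrite !addr_ge0 ?rnorm_ge0// mulr_ge0 ?rnorm_ge0.
  move=> e e0 _; rewrite add0r; have [N NP] := inv_small e0.
  have := NP N (leqnn _); set i := N.+1%:R^-1 => iN.
  have := gP (a *: y + z) N; have := gP y N; have := gP z N.
  rewrite -/i bop_add bop_scale; set P := peval _ _ => h1 h2 h3.
  have h4 : rnorm (a *: (P y - g y)) <= i * (complex.Re `|a| * rnorm y).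
    by rewrite rnormZ mulrCA ler_wpM2l.
  have -> : g (a *: y + z) - (a *: g y + g z) =
     - (a *: P y + P z - g (a *: y + z)) + (a *: (P y - g y) + (P z - g z)).
    rewrite scalerBr opprB [X in _ = _ + X]addrACA.
    by rewrite [RHS]addrA subrK opprD.
  apply: le_trans (rnormD _ _) _; rewrite rnormN.
  apply: le_trans (lerD (lexx _) (rnormD _ _)) _.
  apply: (@le_trans _ _ (i * K)).
    by rewrite /K !mulrDr; apply: lerD => //; apply: lerD.
  by rewrite ler_wpM2r// !addr_ge0 ?rnorm_ge0// mulr_ge0 ?rnorm_ge0.
have [M M0 PM] := bop_bounded (peval (p 0%N) T).
have gM x : rnorm (g x) <= (M + 1) * rnorm x.
  have := rnormD (- (peval (p 0%N) T x - g x)) (peval (p 0%N) T x).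
  rewrite opprB subrK -opprB rnormN => h; apply: le_trans h _.
  by have := gP x 0%N; have := PM x; rewrite invr1 mul1r mulrDl; lra.
by have [F FE] := mk_bop glin gM; exists F => k x; rewrite FE.
Qed.

(** [fun_calc] chooses a limit operator if there is one, so its existence has to
    be shown: polynomials close to [f] on [[0, M]], an interval containing the
    spectrum, are Cauchy by [rnorm_peval].  Whichever limit is chosen, and
    along whichever polynomials, [is_calc] holds. *)
Lemma fun_calcP f T (M : R) : rselfadj T -> rcoercive 0 T ->
  (forall x, rdot (T x) x <= M * rnorm x ^+ 2) ->
  (forall e, 0 < e -> exists p : {poly R},
     forall t, 0 <= t <= M -> `|p.[t] - f t| <= e) ->
  is_calc f T (fun_calc f T).
Proof.
move=> Tsa T0 TM fp.
have sT (t : R) : spectrum T t%:C -> 0 <= t <= M by exact: spectrum_bounds.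
suff : exists F : 'B(H), exists p : nat -> {poly R},
    {uniform [set t : R | spectrum T t%:C],
      (fun k t => (p k).[t]) @ \oo --> f} /\
    opnorm (peval (p k) T - F) @[k --> \oo] --> 0.
  move=> /(xgetPex 0)[p [/uniform_polyP pf pF]] e e0.
  have [N1 _ N1P] := pf e e0.
  have [N2 _ N2P] := (cvgrPdistC_le _ _).1 pF e e0.
  pose k := maxn N1 N2; exists (p k) => [t st|x].
    by rewrite distrC ltW//; apply: (N1P _ (leq_maxl N1 N2)).
  have := N2P _ (leq_maxr N1 N2); rewrite /= subr0 => h.
  apply: le_trans (rnorm_opnorm (peval (p k) T - fun_calc f T) x) _.
  by rewrite ler_wpM2r ?rnorm_ge0// (le_trans (ler_norm _)).
have i0 k : 0 < k.+1%:R^-1 :> R by rewrite invr_gt0 ltr0n.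
have [p pP] := choice (fun k => fp _ (i0 k)).
have [|F FP] := @peval_limit T p Tsa.
  move=> k l x; apply: peval_dist => //.
  move=> t /sT t0M.
  have -> : (p k).[t] - (p l).[t] = (p k).[t] - f t - ((p l).[t] - f t) by ring.
  by rewrite (le_trans (ler_normB _ _))// lerD// pP.
exists F, p; split.
  apply/uniform_polyP => e e0.
  have [N NP] := @inv_small R (e / 2) (divr_gt0 e0 (ltr0Sn _ 1)).
  exists N => // k /= Nk t /sT t0M; rewrite distrC.
  by have := pP k t t0M; have := NP k Nk; move: k.+1%:R^-1 => i; lra.
apply/cvgrPdistC_le => e e0; have [N NP] := inv_small e0.
exists N => // k /= Nk; rewrite subr0 ger0_norm ?opnorm_ge0//.
apply: opnorm_le => [|x]; first exact: ltW.
by apply: le_trans (FP k x) _; rewrite ler_wpM2r ?rnorm_ge0// NP.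
Qed.

Lemma is_calc_selfadj f T F : rselfadj T -> is_calc f T F -> rselfadj F.
Proof.
move=> Tsa TF x y; apply/eqP; rewrite -subr_eq0 -normr_eq0 eq_le normr_ge0 andbT.
have K0 : 0 <= 2 * (rnorm x * rnorm y) by rewrite !mulr_ge0 ?rnorm_ge0.
apply: (le_of_small K0) => e e0 _; rewrite add0r.
have [p _ pF] := TF e e0.
have -> : rdot (F x) y - rdot x (F y) =
    rdot x (peval p T y - F y) - rdot (peval p T x - F x) y.
  by rewrite rdotBl rdotBr (rselfadj_peval p Tsa x y); ring.
apply: le_trans (ler_normB _ _) _.
have h1 : `|rdot x (peval p T y - F y)| <= e * (rnorm x * rnorm y).
  apply: le_trans (rdot_CS _ _) _.
  by rewrite mulrCA ler_wpM2l ?rnorm_ge0.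
have h2 : `|rdot (peval p T x - F x) y| <= e * (rnorm x * rnorm y).
  apply: le_trans (rdot_CS _ _) _.
  by rewrite mulrA ler_wpM2r ?rnorm_ge0.
by apply: le_trans (lerD h1 h2) _; rewrite le_eqVlt; apply/orP; left; apply/eqP; ring.
Qed.

(** Monotonicity against polynomials, enough here because tangent lines are
    polynomials. *)
Lemma is_calc_ge f T F q x : rselfadj T -> is_calc f T F ->
  (forall t : R, spectrum T t%:C -> q.[t] <= f t) ->
  rdot (peval q T x) x <= rdot (F x) x.
Proof.
move=> Tsa TF qf; have K0 : 0 <= 2 * rnorm x ^+ 2 by rewrite mulr_ge0 ?sqr_ge0.
apply: (le_of_small K0) => e e0 _.
have [p pf pF] := TF e e0.
have := @peval_ge0 R H T (p + e%:P - q) Tsa.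
have h (t : R) : spectrum T t%:C -> 0 <= (p + e%:P - q).[t].
  move=> st; have := pf t st; have := qf t st.
  by rewrite ler_norml !hornerE => ? /andP[? _]; lra.
move=> /(_ h x); rewrite mul0r pevalB pevalD pevalC.
rewrite -[X in rdot X _]/(peval p T x + e%:C *: x - peval q T x).
rewrite rdotBl rdotDl rdotZl rdotxx => h1.
have h2 : rdot (peval p T x - F x) x <= e * rnorm x ^+ 2.
  apply: le_trans (ler_norm _) _; apply: le_trans (rdot_CS _ _) _.
  by rewrite expr2 mulrA ler_wpM2r ?rnorm_ge0.
by move: h2; rewrite rdotBl => h2; lra.
Qed.

(** One half of [F ^ 2 = T].  If [p] is [e]-close to the square root [s] of [t],
    then [p ^ 2 >= s ^ 2 - 2 e s >= (1 - e) t - e], and both sides are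
    polynomials in [t] to which [peval_ge0] applies. *)
Lemma is_calc_sqrt T F x : rselfadj T -> rcoercive 0 T ->
  is_calc (fun t => t `^ 2^-1) T F -> rdot (T x) x <= rnorm (F x) ^+ 2.
Proof.
move=> Tsa T0 TF.
have [M M0 TM] := quad_bounded T.
have sT (t : R) : spectrum T t%:C -> 0 <= t <= M by exact: spectrum_bounds.
have t0 : 0 <= rdot (T x) x by have := T0 x; rewrite mul0r.
have x0 := rnorm_ge0 x; have f0 := rnorm_ge0 (F x).
pose K := rdot (T x) x + (2 * rnorm x ^+ 2 + 2 * (rnorm (F x) * rnorm x)).
have K0 : 0 <= K by rewrite /K; nra.
apply: (le_of_small K0) => e e0 e1.
have [p pf pF] := TF e e0.
have := @peval_ge0 R H T (p * p - ((1 - e)%:P * 'X - e%:P)) Tsa.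
have h (t : R) : spectrum T t%:C -> 0 <= (p * p - ((1 - e)%:P * 'X - e%:P)).[t].
  move=> st; have := pf t st; have /andP[tge0 _] := sT t st.
  rewrite !hornerE powR12_sqrt//; have := sqrtr_ge0 t; have := sqr_sqrtr tge0.
  move: (Num.sqrt t) p.[t] => s u <- s0; rewrite ler_norml => /andP[u1 u2].
  have : 0 <= e * (s - 1) ^+ 2 by rewrite mulr_ge0 ?sqr_ge0// ltW.
  have : 0 <= s * (u - s + e) by rewrite mulr_ge0//; lra.
  have : 0 <= (u - s) ^+ 2 by rewrite sqr_ge0.
  by nra.
move=> /(_ h x); rewrite mul0r !pevalB !pevalM !pevalC pevalX.
rewrite -[X in rdot X _]/(peval p T (peval p T x) - ((1 - e)%:C *: (T x) - e%:C *: x)).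
rewrite !(rdotBl, rdotZl) (rselfadj_peval p Tsa (peval p T x)) !rdotxx => h1.
have h2 : rnorm (peval p T x) <= e * rnorm x + rnorm (F x).
  have := rnormD (peval p T x - F x) (F x); rewrite subrK => h2.
  by apply: le_trans h2 _; rewrite lerD2r.
have h3 : rnorm (peval p T x) ^+ 2 <= (e * rnorm x + rnorm (F x)) ^+ 2.
  by rewrite lerXn2r ?nnegrE ?rnorm_ge0// addr_ge0// mulr_ge0// ltW.
have h4 : e * (e * rnorm x ^+ 2) <= e * rnorm x ^+ 2.
  by rewrite ler_wpM2l ?(ltW e0)// -[leRHS]mul1r ler_wpM2r ?sqr_ge0.
rewrite /K.
have -> : rnorm (F x) ^+ 2 +
   e * (rdot (T x) x + (2 * rnorm x ^+ 2 + 2 * (rnorm (F x) * rnorm x))) =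
   (e * rnorm x + rnorm (F x)) ^+ 2 + e * rdot (T x) x + e * rnorm x ^+ 2 +
   (e * rnorm x ^+ 2 - e * (e * rnorm x ^+ 2)) by ring.
lra.
Qed.

Lemma rselfadj_gram X : rselfadj (adjoint X * X).
Proof.
move=> x y; rewrite -[LHS]/(rdot (adjoint X (X x)) y).
by rewrite rdotC -rdot_adjoint rdotC rdot_adjoint.
Qed.

Lemma rdot_gram X x : rdot ((adjoint X * X) x) x = rnorm (X x) ^+ 2.
Proof.
rewrite -[LHS]/(rdot (adjoint X (X x)) x).
by rewrite rdotC -rdot_adjoint rdotxx.
Qed.

Lemma opabsP X : [/\ rselfadj (opabs X), rcoercive 0 (opabs X) &
  forall x, rnorm (X x) ^+ 2 <= rnorm (opabs X x) ^+ 2].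
Proof.
have Gsa := rselfadj_gram X; set G := adjoint X * X in Gsa.
have G0 : rcoercive 0 G by move=> x; rewrite mul0r rdot_gram sqr_ge0.
have [M M0 GM] := quad_bounded G.
have GF : is_calc (fun t => t `^ 2^-1) G (opabs X).
  apply: fun_calcP GM _ => // e e0; apply: poly_approx => // d d0.
  exact: sqrt_modulus.
split=> [|x|x]; first exact: is_calc_selfadj GF.
  have := is_calc_ge (q := 0) x Gsa GF; rewrite mul0r.
  rewrite -[X in peval X _]/(0%:P) pevalC scale0r rdot0l; apply => t _.
  by rewrite horner0 powR_ge0.
by rewrite -rdot_gram; exact: is_calc_sqrt GF.
Qed.

(** McCarthy's inequality [<|X|^(2r) x, x> >= <|X|^2 x, x>^r] for unit
    vectors, linearised and made homogeneous: the tangent line of the power at an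
    arbitrary [mu], taken at [t ^ 2] for [t] in the spectrum of [|X|].  Leaving
    [mu] free lets one and the same tangent serve for several operators. *)
Lemma oppow_opabs_ge X (r mu : R) x : 1 <= r -> 0 <= mu ->
  r * mu `^ (r - 1) * rnorm (X x) ^+ 2 - (r - 1) * mu `^ r * rnorm x ^+ 2 <=
  rdot (oppow (opabs X) (2 * r) x) x.
Proof.
move=> r1 mu0; have [Psa P0 XP] := opabsP X; set P := opabs X in Psa P0 XP *.
have [M M0 PM] := quad_bounded P.
have PF : is_calc (fun t => t `^ (2 * r)) P (oppow P (2 * r)).
  apply: fun_calcP PM _ => // e e0; apply: poly_approx => // d d0.
  by apply: powR_modulus => //; lra.
pose c := r * mu `^ (r - 1).
have c0 : 0 <= c by rewrite mulr_ge0 ?powR_ge0//; lra.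
pose q : {poly R} := c%:P * ('X * 'X) - ((r - 1) * mu `^ r)%:P.
apply: le_trans (_ : rdot (peval q P x) x <= _); last first.
  apply: is_calc_ge PF _ => // t /(spectrum_bounds Psa P0 PM)/andP[t0 _].
  rewrite powRrM (powR_mulrn 2 t0).
  have -> : q.[t] = c * t ^+ 2 - (r - 1) * mu `^ r by rewrite /q !hornerE; ring.
  exact: powR_tangent (sqr_ge0 t) mu0.
rewrite /q pevalB !pevalM !pevalC pevalX.
rewrite -[X in _ <= rdot X _]/(c%:C *: P (P x) - ((r - 1) * mu `^ r)%:C *: x).
rewrite rdotBl !rdotZl (Psa (P x)) !rdotxx lerD2r.
by rewrite ler_wpM2l.
Qed.

End FunctionalCalculus.

(** * Numerical radius *)

Section NumericalRadius.
Local Open Scope complex_scope.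
Local Open Scope classical_set_scope.
Context {R : realType}.

Lemma sup_powR_le (E : set R) (r K : R) : 0 < r -> 0 <= K ->
  (forall a, E a -> 0 <= a) -> (forall a, E a -> a `^ r <= K) ->
  sup E `^ r <= K.
Proof.
move=> r0 K0 E0 EK.
have [->|/set0P[a Ea]] := eqVneq E set0; first by rewrite sup0 powR0// gt_eqF.
have r1 : r^-1 * r = 1 by rewrite mulVf// gt_eqF.
have ubE : ubound E (K `^ r^-1).
  move=> b Eb; have b0 := E0 _ Eb.
  rewrite -[leLHS](powRr1 b0) -r1 [r^-1 * r]mulrC powRrM.
  by rewrite ge0_ler_powR ?nnegrE ?invr_ge0 ?(ltW r0) ?powR_ge0// EK.
have sE : sup E <= K `^ r^-1 by apply: ge_sup => //; exists a.
have s0 : 0 <= sup E.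
  by apply: le_trans (E0 _ Ea) _; apply: ub_le_sup => //; exists (K `^ r^-1).
apply: (@le_trans _ _ ((K `^ r^-1) `^ r)).
  by rewrite ge0_ler_powR ?nnegrE ?powR_ge0// ltW.
by rewrite -powRrM r1 powRr1.
Qed.

(** The one-factorisation case.  For a unit vector, [`|<T x, x>|] is at most half
    the sum of the [2 n] numbers [a i] and [b i]; with [mu] their mean, summing
    the [2 n] tangent inequalities at [mu] cancels the linear terms and leaves
    [2 n mu `^ r]. *)
Lemma numrad_powR_le (H : hilbertType R) (n : nat) (X Y : 'I_n -> 'B(H)) (r : R) :
  (0 < n)%N -> 1 <= r ->
  numrad (\sum_(i < n) Y i * X i) `^ r <= n%:R `^ (r - 1) / 2 *
  opnorm (\sum_(i < n)
    (oppow (opabs (X i)) (2 * r) + oppow (opabs (adjoint (Y i))) (2 * r))).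
Proof.
move=> n0 r1; have r0 : 0 < r by lra.
set S := \sum_(i < n) (_ + _); set T := \sum_(i < n) _.
apply: sup_powR_le => //.
- by rewrite mulr_ge0 ?opnorm_ge0// divr_ge0// powR_ge0.
- by move=> _ [x _ <-]; rewrite -lecR RRe_real ?normr_real//; exact: normr_ge0.
move=> _ [x xn <-].
have x1 : rnorm x = 1 by rewrite /rnorm (xn : `|x| = 1).
pose a i := rnorm (X i x) ^+ 2; pose b i := rnorm (adjoint (Y i) x) ^+ 2.
pose s := \sum_(i < n) (a i + b i).
have s0 : 0 <= s by apply: sumr_ge0 => i _; rewrite addr_ge0// sqr_ge0.
have N0 : 0 < n%:R :> R by rewrite ltr0n.
pose mu := s / (2 * n%:R).
have mu0 : 0 <= mu by rewrite divr_ge0// mulr_ge0// ltW.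
have smu : s = 2 * n%:R * mu by rewrite /mu; field; exact: lt0r_neq0.
have Re_le (I : finType) (F : I -> R[i]) :
    complex.Re `|\sum_i F i| <= \sum_i complex.Re `|F i|.
  rewrite -raddf_sum/=.
  by have := ler_norm_sum (index_enum I) F xpredT; rewrite lecE => /andP[].
have ws : complex.Re `|hdot (T x) x| <= n%:R * mu.
  have -> : hdot (T x) x = \sum_(i < n) hdot (X i x) (adjoint (Y i) x).
    rewrite bop_suml linear_sumlz; apply: eq_bigr => i _.
    by rewrite -adjointP.
  apply: le_trans (Re_le _ _) _.
  apply: (@le_trans _ _ (\sum_(i < n) (a i + b i) / 2)).
    by apply: ler_sum => i _; exact: norm_hdot_le.
  by rewrite -mulr_suml -/s smu; lra.
have Sx : 2 * n%:R * mu `^ r <= opnorm S.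
  apply: (@le_trans _ _ (rdot (S x) x)); last first.
    apply: le_trans (ler_norm _) _; apply: le_trans (rdot_CS _ _) _.
    by have := rnorm_opnorm S x; rewrite x1 !mulr1.
  pose c := r * mu `^ (r - 1); pose d := (r - 1) * mu `^ r.
  rewrite bop_suml rdot_suml.
  apply: (@le_trans _ _ (\sum_(i < n) (c * (a i + b i) - 2 * d))).
    rewrite big_split/= -mulr_sumr -/s sumr_const card_ord -mulr_natl smu.
    rewrite /c /d -(mulr_powRB1 mu0 r0) le_eqVlt; apply/orP; left; apply/eqP.
    ring.
  apply: ler_sum => i _.
  rewrite -[X in rdot X _]/(oppow (opabs (X i)) (2 * r) x +
    oppow (opabs (adjoint (Y i))) (2 * r) x) rdotDl.
  have unit_ge (Z : 'B(H)) :
      c * rnorm (Z x) ^+ 2 - d <= rdot (oppow (opabs Z) (2 * r) x) x.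
    by have := oppow_opabs_ge Z x r1 mu0; rewrite x1 expr1n mulr1.
  have := lerD (unit_ge (X i)) (unit_ge (adjoint (Y i))).
  by apply: le_trans; rewrite le_eqVlt /a /b; apply/orP; left; apply/eqP; ring.
apply: (@le_trans _ _ ((n%:R * mu) `^ r)).
  rewrite ge0_ler_powR ?nnegrE ?(ltW r0) ?mulr_ge0 ?(ltW N0)//.
  by rewrite -lecR RRe_real ?normr_real//; exact: normr_ge0.
apply: (@le_trans _ _ (n%:R `^ (r - 1) / 2 * (2 * n%:R * mu `^ r))); last first.
  by rewrite ler_wpM2l// divr_ge0// powR_ge0.
rewrite powRM ?(ltW N0)// -(mulr_powRB1 (ltW N0) r0).
by rewrite le_eqVlt; apply/orP; left; apply/eqP; field.
Qed.

End NumericalRadius.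

Theorem theorem3p5 (R : realType) (H : hilbertType R) (n m : nat)
    (n_ge1 : (1 <= n)%N) (m_ge1 : (1 <= m)%N)
    (A C D : 'I_n -> 'B(H)) (r : R) (r_ge1 : 1 <= r) :
  numrad (\sum_(i < n) D i * C i ^+ m * A i) `^ r <=
  n%:R `^ (r - 1) / (2 * m%:R) *
  \sum_(1 <= j < m.+1)
    opnorm (\sum_(i < n)
      (oppow (opabs (C i ^+ j * A i)) (2 * r) +
       oppow (opabs (adjoint (D i * C i ^+ (m - j)))) (2 * r))).
Proof.
(* Each of the [m] factorisations [(D C^(m-j)) (C^j A)] of the same operator
   bounds the left-hand side; the right-hand side is the mean of the bounds. *)
have M0 : 0 < m%:R :> R by rewrite ltr0n.
set w := numrad _ `^ r; set q := n%:R `^ (r - 1).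
have -> : w = m%:R^-1 * \sum_(1 <= j < m.+1) w.
  rewrite big_const_nat subSS subn0 iter_addr_0 -[w *+ m]mulr_natl mulKf//.
  exact: lt0r_neq0.
have -> : q / (2 * m%:R) = m%:R^-1 * (q / 2) by field; exact: lt0r_neq0.
rewrite -mulrA ler_wpM2l ?invr_ge0 ?(ltW M0)// mulr_sumr.
rewrite big_nat_cond [leRHS]big_nat_cond; apply: ler_sum => j.
rewrite andbT ltnS => /andP[_ jm].
have -> : w = numrad (\sum_(i < n)
    (D i * C i ^+ (m - j)) * (C i ^+ j * A i)) `^ r.
  congr (numrad _ `^ r); apply: eq_bigr => i _.
  by rewrite mulrA -[in RHS](mulrA (D i)) -exprD subnK.
exact: numrad_powR_le.
Qed.
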